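(* Let $\mathcal{H}_1,\mathcal{H}_2$ be finite-dimensional Hilbert spaces, each with a fixed computational basis, and equip $\mathcal{H}_1\otimes\mathcal{H}_2$ with the product basis. Let $\alpha\in(0,1)$ and $z\geqslant\max\{\alpha,1-\alpha\}$. For any density matrices $\rho\in\mathcal{D}(\mathcal{H}_1)$ and $\delta\in\mathcal{D}(\mathcal{H}_2)$, $$\mathcal{T}^{\mathrm{GR}}_{\alpha,z}(\rho)+\mathcal{T}^{\mathrm{GR}}_{\alpha,z}(\delta)\geqslant\mathcal{T}^{\mathrm{GR}}_{\alpha,z}(\rho\otimes\delta)\geqslant\mathcal{T}^{\mathrm{GR}}_{\alpha,z}(\rho)\,\mathcal{T}^{\mathrm{GR}}_{\alpha,z}(\delta).$$
   Context: $\mathcal{D}(\mathcal{H})$ is the set of density matrices (positive semidefinite, trace one) on $\mathcal{H}$. For a $d$-dimensional space with computational basis $\{|j\rangle\}_{j=1}^d$, the texture-free state is $f_1=|f_1\rangle\langle f_1|$ with $|f_1\rangle=\frac{1}{\sqrt d}\sum_{j=1}^d|j\rangle$; the texture-free state of $\mathcal{H}_1\otimes\mathcal{H}_2$ is the tensor product of the texture-free states of $\mathcal{H}_1$ and $\mathcal{H}_2$. On each space, $\mathcal{T}^{\mathrm{GR}}_{\alpha,z}(\rho)=1-f_{\alpha,z}(f_1\|\rho)$ with $f_1$ the texture-free state of that space, where $f_{\alpha,z}(\tau\|\sigma)=\operatorname{Tr}[(\tau^{\frac{\alpha}{2z}}\sigma^{\frac{1-\alpha}{z}}\tau^{\frac{\alpha}{2z}})^z]$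 and powers of positive semidefinite operators are defined by functional calculus. *)

(* Defs.v *)
From HB Require Import structures.
From mathcomp Require Import all_boot all_order all_algebra.
From mathcomp Require Import sesquilinear spectral.
From mathcomp Require Import complex mxtens.
From mathcomp Require Import reals exp.

Set Implicit Arguments.
Unset Strict Implicit.
Unset Printing Implicit Defensive.

Import Order.TTheory GRing.Theory Num.Theory.

Local Open Scope ring_scope.
Local Open Scope complex_scope.
Local Open Scope sesquilinear_scope.

(* A d-dimensional Hilbert space with a fixed orthonormal (computational)
   basis is C^d, operators on it are 'M[R[i]]_d, and the tensor product with
   the product basis is the Kronecker product [*t] of mxtens. *)

Definition psdmx (R : realType) (d : nat) (A : 'M[R[i]]_d) : Prop :=
  A \is hermsymmx /\ forall v : 'cV[R[i]]_d, 0 <= (v ^t* *m A *m v) 0 0.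

Definition density (R : realType) (d : nat) (rho : 'M[R[i]]_d) : Prop :=
  psdmx rho /\ \tr rho = 1.

(* A^p by functional calculus: spectralmx A is unitary and
   A = (spectralmx A)^-1 *m diag_mx (spectral_diag A) *m spectralmx A for
   normal A. For A positive semidefinite the eigenvalues are real and
   nonnegative, so that complex.Re only changes their type. The value at
   other matrices is irrelevant. Recall that 0 `^ p = 0 for p != 0. *)
Definition mxpow (R : realType) (d : nat) (A : 'M[R[i]]_d) (p : R) : 'M_d :=
  invmx (spectralmx A)
    *m diag_mx (map_mx (fun x : R[i] => (complex.Re x `^ p)%:C)
                       (spectral_diag A))
    *m spectralmx A.

(* The trace is a real number (see [mxtrace_mxpow] below), so that taking its
   real part loses nothing. *)
Definition faz (R : realType) (d : nat) (alpha z : R)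
    (tau sigma : 'M[R[i]]_d) : R :=
  complex.Re (\tr (mxpow (mxpow tau (alpha / (2 * z))
                            *m mxpow sigma ((1 - alpha) / z)
                            *m mxpow tau (alpha / (2 * z))) z)).

Definition texture_free_ket (R : realType) (d : nat) : 'cV[R[i]]_d :=
  ((Num.sqrt d%:R)^-1)%:C *: \sum_(j < d) delta_mx j 0.

Definition texture_free (R : realType) (d : nat) : 'M[R[i]]_d :=
  texture_free_ket R d *m (texture_free_ket R d) ^t*.

Definition texture_GR (R : realType) (d : nat) (alpha z : R)
    (rho : 'M[R[i]]_d) : R :=
  1 - faz alpha z (texture_free R d) rho.

Lemma mxtrace_mxpow (R : realType) (d : nat) (A : 'M[R[i]]_d) (p : R) :
  \tr (mxpow A p) = (\sum_i complex.Re (spectral_diag A 0 i) `^ p)%:C.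
Proof.
rewrite /mxpow mxtrace_mulC mulmxA mulmxV ?spectral_unit// mul1mx mxtrace_diag.
by rewrite rmorph_sum /=; apply: eq_bigr => i _; rewrite !mxE.
Qed.

Lemma mxpow1 (R : realType) (d : nat) (A : 'M[R[i]]_d) :
  psdmx A -> mxpow A 1 = A.
Proof.
move=> [hA pA]; rewrite [RHS](orthomx_spectralP (hermitian_normalmx hA)).
rewrite /mxpow; congr (_ *m diag_mx _ *m _); apply/rowP => i; rewrite !mxE.
set u := (row i (spectralmx A)) ^t*.
have eu : (u ^t* *m A *m u) 0 0 = spectral_diag A 0 i.
  transitivity ((spectralmx A *m A *m (spectralmx A) ^t*) i i).
    rewrite /u trmxCK -row_mul !mxE; apply: eq_bigr => k _; rewrite !mxE.
    by [].
  rewrite -invmx_unitary ?spectral_unitarymx//.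
  rewrite {2}(orthomx_spectralP (hermitian_normalmx hA)) !mulmxA.
  rewrite mulmxV ?spectral_unit// mul1mx -mulmxA mulmxV ?spectral_unit//.
  by rewrite mulmx1 !mxE eqxx mulr1n.
have := pA u; rewrite eu; case: (spectral_diag A 0 i) => a b.
by rewrite lecE /= => /andP[/eqP -> a0]; rewrite powRr1.
Qed.

(* The texture-free state of a tensor product, defined through the product
   basis, is the tensor product of the texture-free states. *)
Lemma texture_free_tens (R : realType) (m n : nat) :
  texture_free R (m * n) = texture_free R m *t texture_free R n.
Proof.
have ketE d i j : texture_free_ket R d i j = ((Num.sqrt d%:R)^-1)%:C.
  rewrite !mxE summxE (bigD1 i) //= big1 ?addr0 => [|k ki].
    by rewrite mxE ord1 !eqxx mulr1.
  by rewrite mxE eq_sym (negbTE ki).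
have tfE d i j : texture_free R d i j = (d%:R^-1)%:C.
  have -> : texture_free R d i j =
      texture_free_ket R d i 0 * (texture_free_ket R d j 0)^*%R.
    rewrite [LHS]mxE big_ord1; congr (_ * _); rewrite [LHS]mxE.
    by rewrite [X in Num.conj X]mxE.
  rewrite !ketE conj_Creal ?complex_real// -rmorphM /= -invfM -expr2.
  by rewrite sqr_sqrtr ?ler0n.
apply/matrixP => i j.
by rewrite [RHS]mxE !tfE -rmorphM /= natrM invfM.
Qed.

(* Main.v *)
(* The texture-free state P = |f><f| is a rank-one projector, so P^s = P for
   s <> 0 and P sigma^q P = c P with c = <f|sigma^q|f>; hence
   f_{alpha,z}(P || sigma) = c^z. For a density matrix c is an average of the
   q-th powers of eigenvalues in [0, 1], so c^z lies in [0, 1]; and c is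
   multiplicative under tensor products. With x = c_rho^z and y = c_delta^z the
   claim reads (1 - x) + (1 - y) >= 1 - x y >= (1 - x) (1 - y). *)

Require Import Defs.
From mathcomp Require Import all_boot all_order all_algebra.
From mathcomp Require Import sesquilinear spectral.
From mathcomp Require Import complex mxtens.
From mathcomp Require Import reals exp.
From mathcomp Require Import lra.

Import Order.TTheory GRing.Theory Num.Theory.

Local Open Scope ring_scope.
Local Open Scope complex_scope.
Local Open Scope sesquilinear_scope.

(** * Adjoints, Kronecker products and unitary matrices *)

Lemma adjoint_mul (C : numClosedFieldType) (m n p : nat)
    (A : 'M[C]_(m, n)) (B : 'M[C]_(n, p)) :
  (A *m B) ^t* = B ^t* *m A ^t*.
Proof. by rewrite trmx_mul map_mxM. Qed.

Lemma adjoint_tens (C : numClosedFieldType) (m n p q : nat)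
    (A : 'M[C]_(m, n)) (B : 'M[C]_(p, q)) :
  (A *t B) ^t* = A ^t* *t B ^t*.
Proof. by rewrite trmx_tens map_mxT. Qed.

Lemma tens_diag_mx (C : comPzRingType) (m n : nat)
    (D : 'rV[C]_m) (E : 'rV[C]_n) :
  diag_mx D *t diag_mx E =
  diag_mx (\row_k (D 0 (mxtens_unindex k).1 * E 0 (mxtens_unindex k).2)).
Proof.
apply/matrixP => i j; case: (mxtens_indexP i) => i1 i2.
case: (mxtens_indexP j) => j1 j2.
rewrite tensmxE !mxE mxtens_indexK (can_eq (@mxtens_indexK _ _)) xpair_eqE /=.
by case: (i1 == j1); case: (i2 == j2); rewrite ?mulr1n ?mulr0n ?mulr0 ?mul0r.
Qed.

Lemma tens_mx1 (C : comPzRingType) (m n : nat) :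
  (1%:M : 'M[C]_m) *t (1%:M : 'M[C]_n) = 1%:M.
Proof.
rewrite -!diag_const_mx tens_diag_mx; congr diag_mx.
by apply/rowP => k; rewrite !mxE mulr1.
Qed.

Lemma tens_unitarymx (C : numClosedFieldType) (m n : nat)
    (U : 'M[C]_m) (V : 'M[C]_n) :
  U \is unitarymx -> V \is unitarymx -> U *t V \is unitarymx.
Proof.
move=> /unitarymxP uU /unitarymxP uV; apply/unitarymxP.
by rewrite adjoint_tens tensmx_mul uU uV tens_mx1.
Qed.

Lemma unitarymx_mulVmx (C : numClosedFieldType) (d : nat) (U : 'M[C]_d) :
  U \is unitarymx -> U ^t* *m U = 1%:M.
Proof.
by move=> uU; rewrite -invmx_unitary// mulVmx// unitarymx_unit.
Qed.

(** * Real diagonal forms and powers of matrices *)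

Definition rdiag (R : realType) (d : nat) (lam : 'I_d -> R) : 'M[R[i]]_d :=
  diag_mx (\row_i (lam i)%:C).

Lemma hermsymmxP (C : numClosedFieldType) (d : nat) (A : 'M[C]_d) :
  reflect (A ^t* = A) (A \is hermsymmx).
Proof.
by rewrite qualifE /= expr0 scale1r eq_sym; exact: eqP.
Qed.

Lemma adjoint_rdiag (R : realType) (d : nat) (lam : 'I_d -> R) :
  (rdiag R d lam) ^t* = rdiag R d lam.
Proof.
rewrite /rdiag tr_diag_mx map_diag_mx; congr diag_mx; apply/rowP => i.
by rewrite !mxE; apply: conj_Creal; rewrite complex_real.
Qed.

Lemma hermsymmx_conj_rdiag (R : realType) (d : nat) (U : 'M[R[i]]_d)
    (lam : 'I_d -> R) :
  U ^t* *m rdiag R d lam *m U \is hermsymmx.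
Proof.
by apply/hermsymmxP; rewrite !adjoint_mul trmxCK adjoint_rdiag mulmxA.
Qed.

Lemma hermsymmx_rdiag (R : realType) (d : nat) (A : 'M[R[i]]_d) :
  A \is hermsymmx ->
  exists U (lam : 'I_d -> R),
    U \is unitarymx /\ A = U ^t* *m rdiag R d lam *m U.
Proof.
move=> hA; exists (spectralmx A), (fun i => complex.Re (spectral_diag A 0 i)).
split; first exact: spectral_unitarymx.
rewrite [LHS](orthomx_spectralP (hermitian_normalmx hA)).
rewrite invmx_unitary ?spectral_unitarymx//.
congr (_ *m diag_mx _ *m _); apply/rowP => i; rewrite mxE.
have /mxOverP/(_ 0 i) := hermitian_spectral_diag_real hA.
by move=> /RRe_real.
Qed.

(* If U diagonalizes A to D and V to E, then W = U V^* intertwines D and E, so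
   W vanishes wherever D i <> E j and hence intertwines D^p and E^p too. *)
Lemma mxpow_conj_rdiag (R : realType) (d : nat) (U : 'M[R[i]]_d)
    (lam : 'I_d -> R) (p : R) :
  U \is unitarymx ->
  mxpow (U ^t* *m rdiag R d lam *m U) p =
  U ^t* *m rdiag R d (fun i => lam i `^ p) *m U.
Proof.
move=> uU; set A := U ^t* *m _ *m U.
have UV := unitarymx_mulVmx _ _ _ uU.
have /unitarymxP VU := uU.
have nA : A \is normalmx by exact/hermitian_normalmx/hermsymmx_conj_rdiag.
have eA := orthomx_spectralP nA; rewrite /mxpow.
set P := spectralmx A in eA *; set E := spectral_diag A in eA *.
have PV : P *m invmx P = 1%:M by rewrite mulmxV ?spectral_unit.
set W := U *m invmx P.
have WE : rdiag R d lam *m W = W *m diag_mx E.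
  have : U *m A *m invmx P = W *m diag_mx E.
    by rewrite {1}eA /W !mulmxA -[_ *m P *m _]mulmxA PV mulmx1.
  by rewrite /A !mulmxA VU mul1mx -mulmxA.
set E' := map_mx _ E; set D' := rdiag _ _ _.
suff WE' : D' *m W = W *m diag_mx E'.
  have -> : invmx P = U ^t* *m W by rewrite /W mulmxA UV mul1mx.
  rewrite -[_ *m W *m _]mulmxA -WE' /W !mulmxA -[_ *m invmx P *m P]mulmxA.
  by rewrite mulVmx ?spectral_unit// mulmx1.
apply/matrixP => i j; move/matrixP: WE => /(_ i j).
rewrite /D' /rdiag !mul_diag_mx !mul_mx_diag !(mxE _ (fun i j => _ * _)).
rewrite [E' 0 j]mxE !(mxE _ (fun _ k => _%:C)).
have [->|w0] := eqVneq (W i j) 0; first by rewrite !mulr0 !mul0r.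
by rewrite [_%:C * _]mulrC => /(mulfI w0) <-; rewrite mulrC.
Qed.

(** The quadratic form at the eigenvector U^* e_i equals [lam i]. *)
Lemma psdmx_rdiag_ge0 (R : realType) (d : nat) (U : 'M[R[i]]_d)
    (lam : 'I_d -> R) (i : 'I_d) :
  U \is unitarymx -> psdmx (U ^t* *m rdiag R d lam *m U) -> 0 <= lam i.
Proof.
move=> /unitarymxP uU [_ /(_ (U ^t* *m delta_mx i 0))].
rewrite adjoint_mul trmxCK !mulmxA.
do 2 rewrite -[_ *m U *m U ^t*]mulmxA uU mulmx1.
rewrite /rdiag mul_mx_diag mxE (bigD1 i) //= big1 => [|k /negbTE ki].
  by rewrite !mxE !eqxx /= rmorph1 mul1r mulr1 addr0 ler0c.
by rewrite !mxE ki mulr0.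
Qed.

(** The eigenvalues are nonnegative and sum to the trace, which is 1, so none of them exceeds 1. *)
Lemma density_rdiag (R : realType) (d : nat) (rho : 'M[R[i]]_d) :
  density rho ->
  exists U (lam : 'I_d -> R),
    [/\ U \is unitarymx, rho = U ^t* *m rdiag R d lam *m U &
        forall i, 0 <= lam i <= 1].
Proof.
move=> [psd tr1]; have [hr _] := psd.
have [U [lam [uU er]]] := hermsymmx_rdiag _ _ _ hr; exists U, lam.
rewrite er in psd tr1; split=> // i.
have lam0 k : 0 <= lam k by exact: psdmx_rdiag_ge0 uU psd.
rewrite lam0 /=; move: tr1.
rewrite mxtrace_mulC mulmxA (unitarymxP uU) mul1mx mxtrace_diag.
under eq_bigr do rewrite mxE.
rewrite -rmorph_sum /= => -[<-].
by rewrite (bigD1 i) //= lerDl sumr_ge0.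
Qed.

(** If U and V diagonalize the factors, then [U *t V] diagonalizes the product, with products of
    eigenvalues on the diagonal. By [mxpow_conj_rdiag] any unitary diagonalization computes [mxpow],
    and real powers are multiplicative on nonnegative reals. *)
Lemma mxpow_tens (R : realType) (m n : nat) (rho : 'M[R[i]]_m)
    (delta : 'M[R[i]]_n) (p : R) :
  density rho -> density delta ->
  mxpow (rho *t delta) p = mxpow rho p *t mxpow delta p.
Proof.
move=> /density_rdiag[U [lam [uU -> lam01]]].
move=> /density_rdiag[V [mu [uV -> mu01]]].
have tensD (a : 'I_m -> R) (b : 'I_n -> R) :
    (U ^t* *m rdiag R m a *m U) *t (V ^t* *m rdiag R n b *m V) =
    (U *t V) ^t* *m
      rdiag R _ (fun k => a (mxtens_unindex k).1 * b (mxtens_unindex k).2)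
      *m (U *t V).
  rewrite -!tensmx_mul adjoint_tens tens_diag_mx; congr (_ *m diag_mx _ *m _).
  by apply/rowP => k; rewrite !mxE rmorphM.
rewrite tensD !mxpow_conj_rdiag ?tens_unitarymx// tensD.
congr (_ *m diag_mx _ *m _); apply/rowP => k; rewrite !mxE powRM//.
- by case/andP: (lam01 (mxtens_unindex k).1).
- by case/andP: (mu01 (mxtens_unindex k).2).
Qed.

(** The eigenvalues of a projector are 0 and 1, so those of c P are 0 and c. Since p is nonzero, 0^p
    = 0 and the kernel of P stays in the kernel of the power. *)
Lemma mxpow_scale_projector (R : realType) (d : nat) (P : 'M[R[i]]_d)
    (c p : R) :
  P \is hermsymmx -> P *m P = P -> p != 0 -> 0 <= c ->
  mxpow (c%:C *: P) p = (c `^ p)%:C *: P.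
Proof.
move=> /hermsymmx_rdiag[U [lam [uU ->]]] PP p0 c0.
have /unitarymxP UV := uU.
have scaleD (a : R) : a%:C *: (U ^t* *m rdiag R d lam *m U) =
    U ^t* *m rdiag R d (fun i => a * lam i) *m U.
  rewrite scalemxAl scalemxAr -linearZ /=; congr (_ *m diag_mx _ *m _).
  by apply/rowP => i; rewrite !mxE rmorphM.
rewrite !scaleD mxpow_conj_rdiag//; congr (_ *m diag_mx _ *m _).
apply/rowP => i; rewrite !mxE; congr _%:C.
(* Idempotence passes to the diagonal form, where it reads lam_i^2 = lam_i. *)
have : rdiag R d lam *m rdiag R d lam = rdiag R d lam.
  have UVK (M : 'M[R[i]]_d) : M *m U *m U ^t* = M by rewrite -mulmxA UV mulmx1.
  have := congr1 (fun M => U *m M *m U ^t*) PP.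
  by rewrite !mulmxA !UVK UV !mul1mx.
move/matrixP => /(_ i i); rewrite /rdiag mul_diag_mx !mxE eqxx mulr1n.
rewrite -rmorphM /= => -[ll].
have /orP[/eqP->|/eqP->] : (lam i == 0) || (lam i == 1).
- rewrite -[lam i == 1]subr_eq0 -mulf_eq0 mulrBr mulr1 ll subrr//.
- by rewrite !mulr0 powR0.
- by rewrite !mulr1.
Qed.

(** * The texture-free projector *)

Lemma adjoint_texture_free (R : realType) (d : nat) :
  (texture_free R d) ^t* = texture_free R d.
Proof. by rewrite /texture_free adjoint_mul trmxCK. Qed.

Lemma texture_free_ket_norm (R : realType) (d : nat) :
  (0 < d)%N -> (texture_free_ket R d) ^t* *m texture_free_ket R d = 1%:M.
Proof.
move=> d0; apply/matrixP => i j; rewrite !ord1 mxE.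
have ketE k : texture_free_ket R d k 0 = ((Num.sqrt d%:R)^-1)%:C.
  rewrite !mxE summxE (bigD1 k) //= big1 ?addr0 => [|l lk].
    by rewrite mxE !eqxx mulr1.
  by rewrite mxE eq_sym (negbTE lk).
under eq_bigr => k _ do
  rewrite 2!mxE ketE conj_Creal ?complex_real// -rmorphM /= -invfM -expr2
    sqr_sqrtr ?ler0n//.
rewrite sumr_const card_ord -rmorphMn /= -mulr_natr mulVf ?mxE//.
by rewrite pnatr_eq0 -lt0n.
Qed.

Lemma texture_free_idem (R : realType) (d : nat) :
  (0 < d)%N -> texture_free R d *m texture_free R d = texture_free R d.
Proof.
move=> d0; rewrite /texture_free mulmxA -[_ *m _ *m texture_free_ket R d]mulmxA.
by rewrite texture_free_ket_norm// mulmx1.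
Qed.

Lemma mxtrace_texture_free (R : realType) (d : nat) :
  (0 < d)%N -> \tr (texture_free R d) = 1.
Proof.
move=> d0; rewrite /texture_free mxtrace_mulC.
by rewrite texture_free_ket_norm// mxtrace1.
Qed.

(** An empty matrix has trace 0, not 1. Positive dimension is what makes the ket [texture_free_ket]
    a unit vector. *)
Lemma density_dim_gt0 (R : realType) (d : nat) (rho : 'M[R[i]]_d) :
  density rho -> (0 < d)%N.
Proof.
case: d rho => // rho [_]; rewrite /mxtrace big_ord0 => /esym/eqP.
by rewrite oner_eq0.
Qed.

(** With w = U |f>, the constant is the average of the lam_i^q with weights |w_i|^2. *)
Lemma texture_free_compress (R : realType) (d : nat) (rho : 'M[R[i]]_d)
    (q : R) :
  0 <= q -> density rho ->
  exists2 c : R, 0 <= c <= 1 &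
    texture_free R d *m mxpow rho q *m texture_free R d =
    c%:C *: texture_free R d.
Proof.
move=> q0 dr; have d0 := density_dim_gt0 _ _ _ dr.
have [U [lam [uU er lam01]]] := density_rdiag _ _ _ dr.
pose w := U *m texture_free_ket R d.
pose a i : R := complex.Re (`|w i 0| ^+ 2).
have aE i : (a i)%:C = `|w i 0| ^+ 2.
  by rewrite /a RRe_real// rpredX// normr_real.
have a0 i : 0 <= a i by rewrite -ler0c aE exprn_ge0.
have wE i : (w ^t*) 0 i = (w i 0)^*%R by rewrite 2!mxE.
have formE (b : 'I_d -> R) :
    w ^t* *m rdiag R d b *m w = (\sum_i b i * a i)%:C%:M.
  apply/matrixP => i j; rewrite !ord1 [RHS]mxE mulr1n mxE rmorph_sum /=.
  apply: eq_bigr => k _; rewrite /rdiag mul_mx_diag mxE [X in _ * X * _]mxE wE.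
  by rewrite rmorphM /= aE normCK mulrAC mulrC [_^*%R * _]mulrC.
(* For b = 1 the form is the squared norm of w, which is that of |f> because U is unitary. *)
have sum_a : \sum_i a i = 1.
  have := formE (fun=> 1); under [in RHS]eq_bigr do rewrite mul1r.
  have -> : rdiag R d (fun=> 1) = 1%:M.
    by rewrite -diag_const_mx; congr diag_mx; apply/rowP => i; rewrite !mxE.
  rewrite mulmx1 /w adjoint_mul mulmxA -[_ *m U]mulmxA.
  rewrite (unitarymx_mulVmx _ _ _ uU) mulmx1 texture_free_ket_norm//.
  move=> /matrixP/(_ 0 0).
  by rewrite !mxE => -[].
exists (\sum_i lam i `^ q * a i).
  rewrite sumr_ge0 => [|i _]; last by rewrite mulr_ge0 ?powR_ge0.
  rewrite -sum_a ler_sum// => i _; rewrite ler_piMl//.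
  case/andP: (lam01 i) => l0 l1; have := ge0_ler_powR q0 l0 ler01 l1.
  by rewrite powR1.
transitivity (texture_free_ket R d *m
    (w ^t* *m rdiag R d (fun i => lam i `^ q) *m w)
      *m (texture_free_ket R d) ^t*).
  by rewrite er mxpow_conj_rdiag// /texture_free /w adjoint_mul !mulmxA.
by rewrite formE mul_mx_scalar -scalemxAl.
Qed.

(** The outer powers of P are P itself, so the operator under the trace is (c P)^z = c^z P, and P
    has trace 1. *)
Lemma faz_projector (R : realType) (d : nat) (alpha z : R)
    (P sigma : 'M[R[i]]_d) (c : R) :
  0 < alpha -> 0 < z ->
  P \is hermsymmx -> P *m P = P -> \tr P = 1 -> 0 <= c ->
  P *m mxpow sigma ((1 - alpha) / z) *m P = c%:C *: P ->
  faz alpha z P sigma = c `^ z.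
Proof.
move=> a0 z0 hP PP trP c0 Pc; rewrite /faz.
have -> : mxpow P (alpha / (2 * z)) = P.
  (* The scalar 1 gives the power of P alone. *)
  have := mxpow_scale_projector R d P 1 (alpha / (2 * z)) hP PP _ ler01.
  rewrite powR1 !scale1r; apply.
  by rewrite mulf_neq0 ?invr_eq0 ?mulf_neq0 ?gt_eqF.
by rewrite Pc mxpow_scale_projector ?gt_eqF// linearZ /= trP mulr1.
Qed.

Theorem proposition3 (R : realType) (m n : nat) (alpha z : R)
    (rho : 'M[R[i]]_m) (delta : 'M[R[i]]_n) :
  0 < alpha -> alpha < 1 ->
  Num.max alpha (1 - alpha) <= z ->
  density rho -> density delta ->
  texture_GR alpha z rho + texture_GR alpha z delta
      >= texture_GR alpha z (rho *t delta) /\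
  texture_GR alpha z (rho *t delta)
      >= texture_GR alpha z rho * texture_GR alpha z delta.
Proof.
move=> a0 a1; rewrite ge_max => /andP[az _] dr dd.
have z0 : 0 < z by exact: lt_le_trans az.
have q0 : 0 <= (1 - alpha) / z by apply: divr_ge0; rewrite ?subr_ge0 ltW.
have [c /andP[c0 c1] Pc] := texture_free_compress R m rho _ q0 dr.
have [e /andP[e0 e1] Pe] := texture_free_compress R n delta _ q0 dd.
have m0 := density_dim_gt0 _ _ _ dr; have n0 := density_dim_gt0 _ _ _ dd.
have mn0 : (0 < m * n)%N by rewrite muln_gt0 m0.
have herm d : texture_free R d \is hermsymmx.
  by apply/hermsymmxP; exact: adjoint_texture_free.
(* All three factors split as Kronecker products, so the two compression constants multiply. *)
have Pce : texture_free R (m * n) *m mxpow (rho *t delta) ((1 - alpha) / z)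
    *m texture_free R (m * n) = (c * e)%:C *: texture_free R (m * n).
  rewrite texture_free_tens mxpow_tens// !tensmx_mul Pc Pe.
  by apply/matrixP => i j; rewrite !mxE rmorphM mulrACA.
rewrite /texture_GR.
rewrite (faz_projector _ _ _ _ _ _ _ a0 z0 _ _ _ c0 Pc)//;
  try exact: texture_free_idem; try exact: mxtrace_texture_free.
rewrite (faz_projector _ _ _ _ _ _ _ a0 z0 _ _ _ e0 Pe)//;
  try exact: texture_free_idem; try exact: mxtrace_texture_free.
rewrite (faz_projector _ _ _ _ _ _ _ a0 z0 _ _ _ (mulr_ge0 c0 e0) Pce)//;
  try exact: texture_free_idem; try exact: mxtrace_texture_free.
have le1 x : 0 <= x -> x <= 1 -> x `^ z <= 1.
  by move=> x0 x1; have := ge0_ler_powR (ltW z0) x0 ler01 x1; rewrite powR1.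
rewrite powRM//.
have := le1 c c0 c1; have := le1 e e0 e1.
have := powR_ge0 c z; have := powR_ge0 e z.
(* The two differences are (1 - x)(1 - y) and x(1 - y) + y(1 - x), both nonnegative on the unit
   square. *)
move: (c `^ z) (e `^ z) => x y y0 x0 y1 x1; split; nra.
Qed.
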